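(* Let $\mathbb{X}\subseteq\mathbb{F}^{\mathbb{N}}$ be a quasi-Banach space. Suppose that the unit vector system $\mathcal{B}_e=(\mathbf{e}_n)_{n=1}^\infty$ is a greedy basis of $\mathbb{X}$ with fundamental function equivalent to the primitive weight $\mathbf{s}=(s_n)_{n=1}^\infty$ of a non-increasing weight $\mathbf{w}=(w_n)_{n=1}^\infty$, and that $\mathbf{s}$ has both the lower regularity property (LRP) and the upper regularity property (URP). Then the unit vector system is a quasi-greedy basis (basic sequence) of $\mathrm{KT}[\mathbb{X},\mathbf{w}]$.
   Context: The scalar field $\mathbb{F}$ is $\mathbb{R}$ or $\mathbb{C}$. A quasi-norm satisfies the axioms of a norm except that the triangle inequality is replaced by $\Vert f+g\Vert\le\kappa(\Vert f\Vert+\Vert g\Vert)$ for some $\kappa\ge1$; a quasi-Banach space is a vector space complete for the topology of a quasi-norm. Two positive sequences are equivalent if each is bounded by a constant times the other. A basis of a quasi-Banach space $\mathbb{Y}$ is a sequence $(\mathbf{x}_n)_{n=1}^\infty$ whose closed linear span is $\mathbb{Y}$ and for which there is a (unique) sequence $(\mathbf{x}_n^* )_{n=1}^\infty$ in $\mathbb{Y}^*$ with $\mathbf{x}_n^*(\mathbf{x}_k)=\delta_{k,n}$; a basic sequence is a basis of its closed linear span. When the unit vector system is a basis of $\mathbb{X}\subseteq\mathbb{F}^{\mathbb{N}}$, elements of $\mathbb{X}$ are identified with their coefficient sequences, i.e., the coordinate functionals are $(a_k)_k\mapsto a_n$. A basis is $M$-bounded if $\sup_n\Vert\mathbf{x}_n\Vert\,\Vert\mathbf{x}_n^*\Vert<\infty$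 and semi-normalized if $0<\inf_n\Vert\mathbf{x}_n\Vert\le\sup_n\Vert\mathbf{x}_n\Vert<\infty$. For finite $A\subseteq\mathbb{N}$, $S_A(f)=\sum_{n\in A}\mathbf{x}_n^*(f)\mathbf{x}_n$; $\mathrm{supp}(f)=\{n:\mathbf{x}_n^*(f)\ne0\}$. A set $A$ is a greedy set of $f$ if $|\mathbf{x}_k^*(f)|\le|\mathbf{x}_n^*(f)|$ for all $n\in A$, $k\in\mathbb{N}\setminus A$. An $M$-bounded semi-normalized basis is quasi-greedy if there is $C$ with $\Vert S_A(f)\Vert\le C\Vert f\Vert$ for all $f$ and all finite greedy sets $A$ of $f$; it is greedy if there is $C$ with $\Vert f-S_A(f)\Vert\le C\Vert f-z\Vert$ whenever $A$ is a finite greedy set of $f$ and $|\mathrm{supp}(z)|\le|A|$. The fundamental function of a basis is $m\mapsto\sup\{\Vert\sum_{n\in A}\varepsilon_n\mathbf{x}_n\Vert:|A|\le m,\ |\varepsilon_n|=1\}$. A weight is a sequence of positive numbers $\mathbf{w}=(w_n)$; its primitive weight is $s_n=\sum_{j=1}^nw_j$. A sequence $(s_m)$ has the URP if there is an integer $b\ge3$ with $s_{bm}\le\frac b2s_m$ for all $m\in\mathbb{N}$, and the LRP if there is an integer $b\ge2$ with $2s_m\le s_{bm}$ for all $m\in\mathbb{N}$. For $f=(a_n)\in\mathbb{F}^{\mathbb{N}}$, $\Vert f\Vert_{\mathbf{w}}=\sup_m\left|\sum_{n=1}^ma_nw_n\right|$. Then $\mathrm{KT}[\mathbb{X},\mathbf{w}]=\{f\in\mathbb{X}:\Vert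 f\Vert_{\mathbf{w}}<\infty\}$ with quasi-norm $\Vert f\Vert_{\mathrm{KT}[\mathbb{X},\mathbf{w}]}=\max\{\Vert f\Vert_{\mathbb{X}},\Vert f\Vert_{\mathbf{w}}\}$. *)

(* Defs.v *)
From HB Require Import structures.
From mathcomp Require Import all_boot all_order all_algebra.
From mathcomp Require Import finmap.
From mathcomp Require Import all_classical all_reals all_analysis.
From mathcomp Require Import complex.
Set Implicit Arguments.
Unset Strict Implicit.
Unset Printing Implicit Defensive.
Import Order.TTheory GRing.Theory Num.Theory.
Import numFieldNormedType.Exports.

Local Open Scope classical_set_scope.
Local Open Scope ring_scope.

(* The norm of R[i] as a numFieldType is R[i]-valued; quasi-norms, suprema and
   weights are real, so the scalar field comes with an R-valued [modulus] and
   an embedding [embed] of the reals. *)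
Variant scalar_kind := RealScalars | ComplexScalars.

Definition scalars (R : realType) (k : scalar_kind) : numFieldType :=
  match k with RealScalars => R | ComplexScalars => R[i] end.

Definition modulus (R : realType) (k : scalar_kind) : scalars R k -> R :=
  match k with
  | RealScalars => fun x : R => `|x|
  | ComplexScalars => fun z : R[i] => Normc.normc z
  end.

Definition embed (R : realType) (k : scalar_kind) : R -> scalars R k :=
  match k with
  | RealScalars => fun x : R => x
  | ComplexScalars => fun x : R => real_complex R x
  end.

(* A space is a linear subspace [Y] of an ambient vector space [V], with a
   quasi-norm [N] of which only the values on [Y] matter. *)
Section Spaces.
Context {R : realType} {k : scalar_kind} {V : lmodType (scalars R k)}.
Implicit Types (Y : set V) (N : V -> R) (x : nat -> V) (phi : V -> scalars R k).

Definition linear_subspace Y : Prop :=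
  Y 0 /\ forall a f g, Y f -> Y g -> Y (a *: f + g).

Record quasi_norm Y N : Prop := QuasiNorm {
  qn_ge0 : forall f, Y f -> 0 <= N f ;
  qn_eq0 : forall f, Y f -> (N f = 0 <-> f = 0) ;
  qn_scale : forall a f, Y f -> N (a *: f) = modulus a * N f ;
  qn_triangle : exists2 kappa : R, 1 <= kappa &
    forall f g, Y f -> Y g -> N (f + g) <= kappa * (N f + N g) }.

(* The topology of a quasi-norm is metrizable, so completeness is sequential. *)
Definition quasi_complete Y N : Prop :=
  forall u : nat -> V, (forall n, Y (u n)) ->
    (forall e : R, 0 < e -> exists n0 : nat, forall m n : nat,
       (n0 <= m)%N -> (n0 <= n)%N -> N (u m - u n) < e) ->
    exists2 f, Y f & (fun n => N (u n - f)) @ \oo --> (0 : R).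

Record quasi_banach Y N : Prop := QuasiBanach {
  qb_subspace : linear_subspace Y ;
  qb_norm : quasi_norm Y N ;
  qb_complete : quasi_complete Y N }.

Definition dual_norm Y N phi : \bar R :=
  ereal_sup [set (modulus (phi f))%:E | f in [set f | Y f /\ N f <= 1]].

Definition in_dual Y N phi : Prop :=
  (forall a f g, Y f -> Y g -> phi (a *: f + g) = a * phi f + phi g) /\
  (dual_norm Y N phi < +oo)%E.

Definition lin_span x : set V :=
  [set f | exists (m : nat) (c : nat -> scalars R k),
     f = \sum_(n < m) c n *: x n].

Definition closed_lin_span Y N x : set V :=
  [set f | Y f /\
     forall e : R, 0 < e -> exists2 g, lin_span x g & N (f - g) < e].

(* Being determined by [Y] and [x], the coordinate functionals [xs] are carried
   along as an explicit argument. *)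
Implicit Type xs : nat -> V -> scalars R k.

Record is_basis Y N x xs : Prop := IsBasis {
  basis_space : quasi_banach Y N ;
  basis_mem : forall n, Y (x n) ;
  basis_span : closed_lin_span Y N x = Y ;
  basis_dual : forall n, in_dual Y N (xs n) ;
  basis_biorth : forall n j, xs n (x j) = (n == j)%:R }.

Definition M_bounded Y N x xs : Prop :=
  (ereal_sup (range (fun n => (N (x n))%:E * dual_norm Y N (xs n))) < +oo)%E.

Definition semi_normalized N x : Prop :=
  (0 < ereal_inf (range (fun n => (N (x n))%:E)))%E /\
  (ereal_sup (range (fun n => (N (x n))%:E)) < +oo)%E.

Definition coord_proj x xs (A : {fset nat}) (f : V) : V :=
  \sum_(n <- A) xs n f *: x n.

Definition supp xs (f : V) : set nat := [set n | xs n f != 0].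

Definition greedy_set xs (f : V) (A : {fset nat}) : Prop :=
  forall n j : nat, n \in A -> j \notin A -> modulus (xs j f) <= modulus (xs n f).

Definition quasi_greedy_basis Y N x xs : Prop :=
  [/\ is_basis Y N x xs, M_bounded Y N x xs, semi_normalized N x &
   exists C : R, forall f (A : {fset nat}), Y f -> greedy_set xs f A ->
     N (coord_proj x xs A f) <= C * N f].

Definition greedy_basis Y N x xs : Prop :=
  [/\ is_basis Y N x xs, M_bounded Y N x xs, semi_normalized N x &
   exists C : R, forall f z (A : {fset nat}), Y f -> Y z ->
     greedy_set xs f A -> (supp xs z #<= [set` A])%card ->
     N (f - coord_proj x xs A f) <= C * N (f - z)].

Definition quasi_greedy_basic_sequence Y N x xs : Prop :=
  quasi_banach Y N /\ quasi_greedy_basis (closed_lin_span Y N x) N x xs.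

Definition fundamental_function N x (m : nat) : \bar R :=
  ereal_sup [set t | exists (A : {fset nat}) (eps : nat -> scalars R k),
    [/\ (#|` A| <= m)%N, (forall n, n \in A -> modulus (eps n) = 1) &
        t = (N (\sum_(n <- A) eps n *: x n))%:E]].

End Spaces.

(* Sequences indexed by the positive integers; extended real values, since a
   fundamental function may a priori be infinite. *)
Definition equivalent_seq {R : realType} (u v : nat -> \bar R) : Prop :=
  exists2 C : R, 0 < C & forall m : nat, (0 < m)%N ->
    (u m <= C%:E * v m)%E /\ (v m <= C%:E * u m)%E.

Section Weights.
Context {R : realType}.
Implicit Types w s : nat -> R.

(* Weights and unit vectors are numbered from 0: [w n] stands for
   w_(n+1), so that [primitive_weight w m] is s_m = w_1 + ... + w_m. *)
Definition weight w : Prop := forall n, 0 < w n.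

Definition primitive_weight w (m : nat) : R := \sum_(n < m) w n.

Definition URP s : Prop :=
  exists2 b : nat, (3 <= b)%N &
    forall m : nat, (0 < m)%N -> s (b * m)%N <= b%:R / 2 * s m.

Definition LRP s : Prop :=
  exists2 b : nat, (2 <= b)%N &
    forall m : nat, (0 < m)%N -> 2 * s m <= s (b * m)%N.

End Weights.

Section KonyaginTemlyakov.
Context {R : realType} {k : scalar_kind}.

(* F^N with its pointwise vector space structure *)
Definition scalar_seq : lmodType (scalars R k) := (nat -> (scalars R k)^o).

Definition unit_vector (n : nat) : scalar_seq := fun j => (j == n)%:R.

Definition coordf (n : nat) (f : scalar_seq) : scalars R k := f n.

Definition wnorm (w : nat -> R) (f : scalar_seq) : \bar R :=
  ereal_sup (range (fun m : nat =>
    (modulus (\sum_(n < m.+1) coordf n f * embed k (w n)))%:E)).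

Definition KT (X : set scalar_seq) (w : nat -> R) : set scalar_seq :=
  [set f | X f /\ (wnorm w f < +oo)%E].

Definition KTnorm (N : scalar_seq -> R) (w : nat -> R) (f : scalar_seq) : R :=
  Num.max (N f) (fine (wnorm w f)).

End KonyaginTemlyakov.

Arguments scalar_seq : clear implicits.

(* Main.v *)
(* A greedy basis is suppression unconditional and democratic, so every f in X
   satisfies t s_|B| <= K' ||f|| whenever its coefficients have modulus at least t
   on the finite set B: X embeds in a weak Lorentz space. Let A be a greedy set of
   f with m elements, and consider a partial sum of the series
   sum_(n in A) a_n w_n. Its part with n <= m is a partial sum for f minus terms
   of modulus at most t = min_A |a_n|, whose total weight is at most t s_m. Its
   part with n > m is at most (s_m / m) sum_(n in A) |a_n|, hence at most
   K' ||f|| (s_m / m) sum_(j <= m) 1 / s_j, and the URP bounds the last sum by a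
   multiple of m / s_m. *)
Require Import Defs.
From mathcomp Require Import all_boot all_order all_algebra finmap.
From mathcomp Require Import all_classical all_reals all_analysis complex.
From mathcomp Require Import ring lra zify.
Set Implicit Arguments.
Unset Strict Implicit.
Import Order.TTheory GRing.Theory Num.Theory.
Import numFieldNormedType.Exports.

Local Open Scope classical_set_scope.
Local Open Scope ring_scope.

(** * The real-valued modulus on real or complex scalars *)

Section Modulus.
Context {R : realType} {k : scalar_kind}.
Implicit Types x y : scalars R k.

Lemma modulus_ge0 x : 0 <= modulus x.
Proof. by case: k x => [|[a b]] /=; [move=> x; exact: normr_ge0|exact: sqrtr_ge0]. Qed.

Lemma modulus0 : modulus (0 : scalars R k) = 0.
Proof. by case: k => /=; [exact: normr0|exact: Normc.normc0]. Qed.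

Lemma modulus1 : modulus (1 : scalars R k) = 1.
Proof. by case: k => /=; [exact: normr1|exact: Normc.normc1]. Qed.

Lemma modulus0_eq0 x : modulus x = 0 -> x = 0.
Proof.
by case: k x => x /=; [move/eqP; rewrite normr_eq0 => /eqP|exact: Normc.eq0_normc].
Qed.

Lemma modulusM x y : modulus (x * y) = modulus x * modulus y.
Proof. by case: k x y => x y /=; [exact: normrM|exact: Normc.normcM]. Qed.

Lemma ler_modulusD x y : modulus (x + y) <= modulus x + modulus y.
Proof. by case: k x y => x y /=; [exact: ler_normD|exact: le_normcD]. Qed.

Lemma modulusN x : modulus (- x) = modulus x.
Proof. by case: k x => x /=; [exact: normrN|exact: normcN]. Qed.

Lemma ler_modulusB x y : modulus (x - y) <= modulus x + modulus y.
Proof. by rewrite -(modulusN y) ler_modulusD. Qed.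

Lemma modulus_embed (r : R) : modulus (embed k r) = `|r|.
Proof.
by case: k => //=; rewrite /Normc.normc /= expr0n /= addr0 sqrtr_sqr.
Qed.

Lemma ler_modulus_sum (I : Type) (r : seq I) (P : pred I) (F : I -> scalars R k) :
  modulus (\sum_(i <- r | P i) F i) <= \sum_(i <- r | P i) modulus (F i).
Proof.
elim/big_rec2: _ => [|i a x _ le_xa]; first by rewrite modulus0.
by rewrite (le_trans (ler_modulusD _ _)) ?lerD2l.
Qed.

End Modulus.

(** * Quasi-normed subspaces and their bounded functionals *)

Section QuasiNorm.
Context {R : realType} {k : scalar_kind} {V : lmodType (scalars R k)}.
Variables (Y : set V) (N : V -> R).
Hypotheses (hY : linear_subspace Y) (hN : quasi_norm Y N).
Implicit Types (f g : V) (phi : V -> scalars R k).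

Lemma subspace0 : Y 0. Proof. by case: hY. Qed.

Lemma subspaceD f g : Y f -> Y g -> Y (f + g).
Proof. by move=> Yf Yg; rewrite -[f]scale1r; case: hY => _; apply. Qed.

Lemma subspaceZ a f : Y f -> Y (a *: f).
Proof. by move=> Yf; rewrite -[_ *: _]addr0; case: hY => Y0; apply. Qed.

Lemma subspaceN f : Y f -> Y (- f).
Proof. by move=> Yf; rewrite -scaleN1r; exact: subspaceZ. Qed.

Lemma subspaceB f g : Y f -> Y g -> Y (f - g).
Proof. by move=> Yf Yg; apply: subspaceD => //; exact: subspaceN. Qed.

Lemma subspace_sum (I : Type) (r : seq I) (F : I -> V) :
  (forall i, Y (F i)) -> Y (\sum_(i <- r) F i).
Proof. by move=> YF; elim/big_rec: _ => [|i f _]; [exact: subspace0|exact: subspaceD]. Qed.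

Lemma quasi_norm0 : N 0 = 0.
Proof. by apply/(qn_eq0 hN); first exact: subspace0. Qed.

Lemma quasi_normN f : Y f -> N (- f) = N f.
Proof. by move=> Yf; rewrite -scaleN1r (qn_scale hN)// modulusN modulus1 mul1r. Qed.

Lemma quasi_normB f g : Y f -> Y g -> N (f - g) = N (g - f).
Proof. by move=> Yf Yg; rewrite -quasi_normN ?opprB//; exact: subspaceB. Qed.

(** Dividing [f] by [N f] puts it in the unit ball over which the dual norm is a supremum; if
    [N f = 0], both sides vanish. Finiteness of the supremum makes [fine] harmless. *)
Lemma in_dual_bound phi f : in_dual Y N phi -> Y f ->
  modulus (phi f) <= fine (dual_norm Y N phi) * N f.
Proof.
move=> [lin_phi fin_phi] Yf.
have phi0 : phi 0 = 0.
  have := lin_phi 1 0 0 subspace0 subspace0.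
  by rewrite scaler0 addr0 mul1r => /eqP; rewrite -subr_eq subrr => /eqP.
have phiZ a g : Y g -> phi (a *: g) = a * phi g.
  by move=> Yg; rewrite -[_ *: _]addr0 lin_phi ?phi0 ?addr0//; exact: subspace0.
have bound g : Y g -> N g <= 1 -> modulus (phi g) <= fine (dual_norm Y N phi).
  move=> Yg Ng; rewrite -lee_fin fineK; first by apply: ereal_sup_ubound; exists g.
  rewrite fin_numElt fin_phi andbT (@lt_le_trans _ _ (modulus (phi g))%:E) ?ltNyr//.
  by apply: ereal_sup_ubound; exists g.
have [/(qn_eq0 hN Yf)->|/eqP Nf0] := eqVneq (N f) 0.
  by rewrite phi0 modulus0 quasi_norm0 mulr0.
have Nf_gt0 : 0 < N f by rewrite lt_def; apply/andP; split; [apply/eqP|exact: (qn_ge0 hN)].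
have := bound (embed k (N f)^-1 *: f) (subspaceZ _ Yf).
rewrite (qn_scale hN)// phiZ// modulusM !modulus_embed gtr0_norm ?invr_gt0//.
by rewrite mulVf ?gt_eqF// => /(_ (lexx _)); rewrite mulrC ler_pdivrMr.
Qed.

End QuasiNorm.

(** * Coordinates of finite combinations, and their uniform bound *)

Section Bases.
Context {R : realType} {k : scalar_kind} {V : lmodType (scalars R k)}.
Variables (Y : set V) (N : V -> R) (x : nat -> V) (xs : nat -> V -> scalars R k).
Hypothesis hx : is_basis Y N x xs.
Implicit Types (f g : V) (A B : {fset nat}) (c d : nat -> scalars R k).

Let hY : linear_subspace Y := qb_subspace (basis_space hx).
Let hN : quasi_norm Y N := qb_norm (basis_space hx).

Definition fset_comb A c : V := \sum_(n <- A) c n *: x n.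

Lemma fset_comb_mem A c : Y (fset_comb A c).
Proof. by apply: subspace_sum => // n; apply: subspaceZ => //; exact: (Defs.basis_mem hx). Qed.

Lemma coord0 j : xs j 0 = 0.
Proof.
have [lin_xs _] := basis_dual hx j.
have := lin_xs 1 0 0 (subspace0 hY) (subspace0 hY).
by rewrite scaler0 addr0 mul1r => /eqP; rewrite -subr_eq subrr => /eqP.
Qed.

Lemma coordD j f g : Y f -> Y g -> xs j (f + g) = xs j f + xs j g.
Proof.
by move=> Yf Yg; have [lin_xs _] := basis_dual hx j; rewrite -[f]scale1r lin_xs// mul1r scale1r.
Qed.

Lemma coord_fset_comb A c j : xs j (fset_comb A c) = if j \in A then c j else 0.
Proof.
have [lin_xs _] := basis_dual hx j.
have -> : xs j (fset_comb A c) = \sum_(n <- A) c n * (j == n)%:R.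
  rewrite /fset_comb; elim: (enum_fset A) => [|n r IHr]; first by rewrite !big_nil coord0.
  rewrite !big_cons lin_xs ?IHr ?(basis_biorth hx)//; first exact: (Defs.basis_mem hx).
  by apply: subspace_sum => // i; apply: subspaceZ => //; exact: (Defs.basis_mem hx).
have [jA|jNA] := boolP (j \in A).
  rewrite (big_fsetD1 j)//= eqxx mulr1 big_seq big1 ?addr0// => n.
  by rewrite !inE eq_sym => /andP[/negPf-> _]; rewrite mulr0.
rewrite big_seq big1// => n nA; case: eqVneq => [jn|]; last by rewrite mulr0.
by rewrite jn nA in jNA.
Qed.

(** M-boundedness controls the products [N (x n)] times the dual norm of [xs n]; dividing by the
    positive infimum of the [N (x n)] leaves one bound for all functionals. *)
Lemma coord_bound : M_bounded Y N x xs -> semi_normalized N x ->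
  exists2 D, 0 <= D & forall n f, Y f -> modulus (xs n f) <= D * N f.
Proof.
move=> Mb [inf_gt0 _].
have [D D_ge0 hD] : exists2 D, 0 <= D & forall n, fine (dual_norm Y N (xs n)) <= D; last first.
  exists D => // n f Yf; apply: le_trans (in_dual_bound hY hN (basis_dual hx n) Yf) _.
  by rewrite ler_wpM2r//; exact: (qn_ge0 hN).
pose i := ereal_inf (range (fun n => (N (x n))%:E)).
have i_fin : i \is a fin_num.
  rewrite fin_numElt (lt_trans _ inf_gt0) ?ltNyr//= (@le_lt_trans _ _ (N (x 0))%:E) ?ltry//.
  by apply: ereal_inf_lbound; exists 0%N.
pose M := ereal_sup (range (fun n => ((N (x n))%:E * dual_norm Y N (xs n))%E)).
have dual_fin n : dual_norm Y N (xs n) = (fine (dual_norm Y N (xs n)))%:E.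
  rewrite fineK// fin_numElt (basis_dual hx n).2 andbT.
  rewrite (@lt_le_trans _ _ (modulus (xs n 0))%:E) ?ltNyr//.
  apply: ereal_sup_ubound; exists 0 => //; rewrite /= (quasi_norm0 hY hN).
  by split=> //; exact: (subspace0 hY).
have leM n : ((N (x n))%:E * dual_norm Y N (xs n) <= M)%E.
  by apply: ereal_sup_ubound; exists n.
have dual_ge0 n : 0 <= fine (dual_norm Y N (xs n)).
  rewrite -lee_fin -dual_fin (@le_trans _ _ (modulus (xs n 0))%:E) ?lee_fin ?modulus_ge0//.
  apply: ereal_sup_ubound; exists 0 => //; rewrite /= (quasi_norm0 hY hN).
  by split=> //; exact: (subspace0 hY).
have N_ge0 n : 0 <= N (x n) by apply: (qn_ge0 hN); exact: (Defs.basis_mem hx).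
have i_gt0 : 0 < fine i by rewrite -lte_fin fineK.
have M_fin : M \is a fin_num.
  by rewrite fin_numElt Mb andbT (lt_le_trans _ (leM 0%N))// dual_fin -EFinM ltNyr.
exists (fine M / fine i) => [|n].
  rewrite divr_ge0 ?(ltW i_gt0)// -lee_fin fineK// (le_trans _ (leM 0%N))//.
  by rewrite dual_fin -EFinM lee_fin mulr_ge0.
rewrite ler_pdivlMr//.
apply: (@le_trans _ _ (fine (dual_norm Y N (xs n)) * N (x n))).
  by rewrite ler_wpM2l// -lee_fin fineK//; apply: ereal_inf_lbound; exists n.
by have := leM n; rewrite dual_fin -EFinM -[M]fineK// lee_fin mulrC.
Qed.

End Bases.

(** * Cardinalities of finite index sets *)

Lemma card_le_fset (A B : {fset nat}) :
  ([set` A] #<= [set` B])%card = (#|` A| <= #|` B|)%N.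
Proof.
have /card_le_eql-> : ([set` A] #= `I_#|` A|)%card by exact/card_eq_fsetP.
have /card_le_eqr-> : ([set` B] #= `I_#|` B|)%card by exact/card_eq_fsetP.
by rewrite card_le_II.
Qed.

Lemma fset_nat_bounded (A : {fset nat}) : exists M, forall n, n \in A -> (n < M)%N.
Proof. by exists (\max_(n <- A) n).+1 => n nA; rewrite ltnS leq_bigmax_seq. Qed.

(** Two overlapping sets will be compared through a third one disjoint from both; [m] consecutive
    indices beyond a bound for [A] provide it. *)
Lemma fresh_fset (A : {fset nat}) (m : nat) :
  exists2 D : {fset nat}, [disjoint A & D]%fset & #|` D| = m.
Proof.
have [M hM] := fset_nat_bounded A.
exists [fset (M + i)%N | i in iota 0 m]%fset.
  apply/fdisjointP => n /hM nM; apply/imfsetP => -[i _ nE].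
  by rewrite nE ltnNge leq_addr in nM.
rewrite card_imfset ?size_iota//=; last exact: addnI.
by rewrite undup_id ?size_iota ?iota_uniq.
Qed.

(** * Suppression unconditionality and democracy of greedy bases *)

Lemma greedy_basis_ge0 {R : realType} {k : scalar_kind} {V : lmodType (scalars R k)}
    (Y : set V) (N : V -> R) (x : nat -> V) (xs : nat -> V -> scalars R k) :
  greedy_basis Y N x xs -> exists2 C : R, 0 <= C &
    forall f z (A : {fset nat}), Y f -> Y z ->
      greedy_set xs f A -> (supp xs z #<= [set` A])%card ->
      N (f - coord_proj x xs A f) <= C * N (f - z).
Proof.
(* The definition allows any real constant, while later estimates multiply inequalities by it, so it
   is made nonnegative. *)
move=> [hx _ _ [C C_greedy]]; exists (Num.max C 0); first by rewrite le_max lexx orbT.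
move=> f z A Yf Yz gA zA; apply: le_trans (C_greedy _ _ _ Yf Yz gA zA) _.
rewrite ler_wpM2r ?le_max ?lexx//; apply: (qn_ge0 (qb_norm (basis_space hx))).
by apply: subspaceB => //; exact: (qb_subspace (basis_space hx)).
Qed.

Section GreedyBases.
Context {R : realType} {k : scalar_kind} {V : lmodType (scalars R k)}.
Variables (Y : set V) (N : V -> R) (x : nat -> V) (xs : nat -> V -> scalars R k).
Hypothesis hx : is_basis Y N x xs.
Variable C : R.
Hypothesis C_greedy : forall f z (A : {fset nat}), Y f -> Y z ->
  greedy_set xs f A -> (supp xs z #<= [set` A])%card ->
  N (f - coord_proj x xs A f) <= C * N (f - z).
Implicit Types (f g : V) (A B : {fset nat}) (c d : nat -> scalars R k).

Let hY : linear_subspace Y := qb_subspace (basis_space hx).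
Let hN : quasi_norm Y N := qb_norm (basis_space hx).

(** A combination over [A] has support inside [A], so it is an admissible competitor. *)
Lemma greedy_fset_comb f A c : Y f -> greedy_set xs f A ->
  N (f - coord_proj x xs A f) <= C * N (f - fset_comb x A c).
Proof.
move=> Yf gA; apply: C_greedy => //; first exact: (fset_comb_mem hx).
apply: subset_card_le => n; rewrite /supp/= (coord_fset_comb hx).
by case: ifP => // _; rewrite eqxx.
Qed.

(* Adding a large multiple of the indicator of [B] makes [B] a greedy set
   without changing [f - S_B f]. *)
Lemma greedy_suppression D : (forall n f, Y f -> modulus (xs n f) <= D * N f) ->
  forall f B, Y f -> N (f - coord_proj x xs B f) <= C * N f.
Proof.
move=> coordD_le f B Yf.
(* On [B] the coefficients of [g] have modulus at least [L - D * N f = D * N f], which bounds every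
   coefficient of [f]. *)
pose L : R := D * N f *+ 2.
pose c := fun _ : nat => embed k L.
pose g := f + fset_comb x B c.
have Yc := fset_comb_mem hx B c.
have Yg : Y g by exact: subspaceD.
have DNf_ge0 : 0 <= D * N f by exact: le_trans (modulus_ge0 _) (coordD_le 0%N f Yf).
have gE n : xs n g = xs n f + if n \in B then c n else 0.
  by rewrite (coordD hx)// (coord_fset_comb hx).
have gB : greedy_set xs g B.
  move=> n j nB jNB; rewrite !gE nB (negPf jNB) addr0.
  rewrite (le_trans (coordD_le j f Yf))//.
  have := ler_modulusB (c n + xs n f) (xs n f); rewrite addrK modulus_embed.
  rewrite ger0_norm ?mulrn_wge0// [c n + _]addrC /L => h.
  by have := coordD_le n f Yf; lra.
have := greedy_fset_comb c Yg gB; rewrite addrK.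
suff -> : g - coord_proj x xs B g = f - coord_proj x xs B f by [].
rewrite /g /coord_proj -/g (eq_big_seq (fun n => xs n f *: x n + c n *: x n)).
  by rewrite big_split /= -/(fset_comb x B c) opprD addrACA subrr addr0.
by move=> n nB; rewrite gE nB scalerDl.
Qed.

(** In the sum of the two combinations [B] is a greedy set, and removing it leaves the part over
    [A]. Subtracting the part over [A] instead is an admissible competitor, with error the part over
    [B]. *)
Lemma greedy_disjoint A B c d (t : R) : [disjoint A & B]%fset ->
  (#|` A| <= #|` B|)%N -> 0 <= t ->
  {in A, forall n, modulus (d n) <= t} -> {in B, forall n, t <= modulus (c n)} ->
  N (fset_comb x A d) <= C * N (fset_comb x B c).
Proof.
move=> disjAB leAB t_ge0 d_le c_ge.
have Yd := fset_comb_mem hx A d; have Yc := fset_comb_mem hx B c.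
pose f := fset_comb x B c + fset_comb x A d.
have fE n : xs n f = (if n \in B then c n else 0) + (if n \in A then d n else 0).
  by rewrite (coordD hx)// !(coord_fset_comb hx).
have Bnot n : n \in B -> n \in A = false.
  by move=> nB; apply/negbTE; move: disjAB; rewrite fdisjoint_sym => /fdisjointP; apply.
have gB : greedy_set xs f B.
  move=> n j nB jNB; rewrite !fE nB (Bnot n nB) (negPf jNB) addr0 add0r.
  apply: le_trans (c_ge n nB); case: ifP => [/d_le//|_].
  by rewrite modulus0.
have := C_greedy (subspaceD hY Yc Yd) Yd gB; rewrite addrK.
have -> : coord_proj x xs B f = fset_comb x B c.
  by apply: eq_big_seq => n nB; rewrite fE nB Bnot// addr0.
rewrite addrAC subrr add0r; apply; apply: card_le_trans (_ : [set` A] #<= _)%card.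
  apply: subset_card_le => n; rewrite /supp/= (coord_fset_comb hx).
  by case: ifP => // _; rewrite eqxx.
by rewrite card_le_fset.
Qed.

(** The projection is [f] minus [f - S_B f], to which suppression and the quasi-triangle inequality
    apply. *)
Lemma greedy_proj_bounded D : 0 <= C -> (forall n f, Y f -> modulus (xs n f) <= D * N f) ->
  exists2 K : R, 0 <= K & forall f B, Y f -> N (coord_proj x xs B f) <= K * N f.
Proof.
move=> C_ge0 coordD_le; have [kappa kappa_ge1 tri] := qn_triangle hN.
have kappa_ge0 : 0 <= kappa by exact: le_trans kappa_ge1.
exists (kappa * (1 + C)) => [|f B Yf]; first by rewrite mulr_ge0// addr_ge0.
have YB : Y (coord_proj x xs B f) by exact: (fset_comb_mem hx).
rewrite -[coord_proj _ _ _ _](subKr f) (le_trans (tri _ _ Yf _))//.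
  by apply: subspaceN => //; exact: subspaceB.
rewrite -mulrA ler_wpM2l// (quasi_normN hN) ?mulrDl ?mul1r ?lerD2l//; last exact: subspaceB.
exact: (greedy_suppression coordD_le).
Qed.

Lemma greedy_comparison D : 0 <= C -> (forall n f, Y f -> modulus (xs n f) <= D * N f) ->
  exists2 K : R, 0 <= K & forall f A B d (t : R), Y f -> (#|` A| <= #|` B|)%N -> 0 <= t ->
    {in A, forall n, modulus (d n) <= t} -> {in B, forall n, t <= modulus (xs n f)} ->
    N (fset_comb x A d) <= K * N f.
Proof.
move=> C_ge0 coordD_le; have [K K_ge0 K_proj] := greedy_proj_bounded C_ge0 coordD_le.
exists (C * (C * K)) => [|f A B d t Yf leAB t_ge0 d_le f_ge]; first by rewrite !mulr_ge0.
have [E disjE cardE] := fresh_fset (A `|` B)%fset #|` B|.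
have disjAE : [disjoint A & E]%fset by exact: fdisjointWl (fsubsetUl A B) disjE.
have disjEB : [disjoint E & B]%fset.
  by rewrite fdisjoint_sym; exact: fdisjointWl (fsubsetUr A B) disjE.
pose e := fun _ : nat => embed k t.
have et n : modulus (e n) = t by rewrite modulus_embed ger0_norm.
have := greedy_disjoint (c := e) disjAE _ t_ge0 d_le _.
rewrite cardE => /(_ leAB) /(_ _)/le_trans; apply; first by move=> n _; rewrite et.
rewrite -!mulrA ler_wpM2l//.
have := greedy_disjoint (d := e) (c := xs^~ f) disjEB _ t_ge0 _ f_ge.
rewrite cardE => /(_ (leqnn _)) /(_ _)/le_trans; apply; first by move=> n _; rewrite et.
rewrite ler_wpM2l//.
exact: K_proj.
Qed.

End GreedyBases.

(** * The weak-type estimate for greedy bases *)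

Section WeakType.
Context {R : realType} {k : scalar_kind} {V : lmodType (scalars R k)}.
Variables (Y : set V) (N : V -> R) (x : nat -> V) (xs : nat -> V -> scalars R k).

(** Some unimodular sum over at most [#|] B|[indices has quasi-norm comparable to]s #|[B|].
    Multiplied by [t], it is dominated by [f] through the comparison of coefficients. *)
Lemma greedy_weak_type (s : nat -> R) : greedy_basis Y N x xs ->
  (forall m, (0 < m)%N -> 0 < s m) -> s 0%N = 0 ->
  equivalent_seq (fundamental_function N x) (fun m => (s m)%:E) ->
  exists2 K : R, 0 <= K & forall f (B : {fset nat}) (t : R), Y f -> 0 <= t ->
    {in B, forall n, t <= modulus (xs n f)} -> t * s #|` B| <= K * N f.
Proof.
move=> hg s_gt0 s0 [E E_gt0 equiv]; have [hx Mb sn _] := hg.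
have [D _ D_bound] := coord_bound hx Mb sn.
have hN := qb_norm (basis_space hx).
have [C C_ge0 C_greedy] := greedy_basis_ge0 hg.
have [K K_ge0 K_comp] := greedy_comparison hx C_greedy C_ge0 D_bound.
exists (2 * E * K) => [|f B t Yf t_ge0 f_ge]; first by rewrite !mulr_ge0// ltW.
have [B0|B_gt0] := posnP #|` B|.
  by rewrite B0 s0 mulr0 !mulr_ge0 ?(ltW E_gt0)//; exact: (qn_ge0 hN).
set m := #|` B| in B_gt0 *.
have sm_gt0 := s_gt0 m B_gt0.
(* The supremum need not be attained. The factor 2 makes the inequality strict, so that an actual
   sum exceeds [s m / (2 * E)]; otherwise the equivalence would give [s m <= s m / 2]. *)
have /ereal_sup_gt[_ [A [eps [leA eps1 ->]]]] :
    ((s m / (2 * E))%:E < fundamental_function N x m)%E.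
  rewrite ltNge; apply/negP => le_sm; have [_] := equiv m B_gt0.
  apply/negP; rewrite -ltNge.
  apply: (@le_lt_trans _ _ (E%:E * (s m / (2 * E))%:E)%E).
    by rewrite lee_wpmul2l// lee_fin ltW.
  rewrite -EFinM lte_fin (_ : E * _ = s m / 2); first lra.
  by field; rewrite gt_eqF.
rewrite lte_fin => lt_sm.
have := K_comp f A B (fun n => embed k t * eps n) t Yf leA t_ge0 => /(_ _ f_ge).
have -> : fset_comb x A (fun n => embed k t * eps n) = embed k t *: fset_comb x A eps.
  by rewrite /fset_comb scaler_sumr; apply: eq_bigr => n _; rewrite scalerA.
rewrite (qn_scale hN) ?modulus_embed ?ger0_norm//; last exact: (fset_comb_mem hx).
move=> h; have {}h : t * N (fset_comb x A eps) <= K * N f.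
  by apply: h => n nA; rewrite modulusM eps1// modulus_embed ger0_norm ?mulr1.
rewrite -mulrA; apply: le_trans (_ : 2 * E * (t * N (fset_comb x A eps)) <= _); last first.
  by rewrite ler_pM2l ?mulr_gt0.
rewrite mulrCA ler_wpM2l// mulrC -ler_pdivrMr ?mulr_gt0//.
exact: ltW.
Qed.

End WeakType.

(** * Primitive weights and the sums of their inverses under the URP *)

Section PrimitiveWeights.
Context {R : realType}.
Variable w : nat -> R.
Hypotheses (hw : weight w) (hmono : nonincreasing_seq w).
Local Notation s := (primitive_weight w).

Lemma primitive_weight0 : s 0 = 0.
Proof. by rewrite /primitive_weight big_ord0. Qed.

Lemma primitive_weightS m : s m.+1 = s m + w m.
Proof. by rewrite /primitive_weight big_ord_recr. Qed.

Lemma primitive_weight_ge0 m : 0 <= s m.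
Proof. by apply: sumr_ge0 => i _; exact/ltW/hw. Qed.

Lemma primitive_weight_gt0 m : (0 < m)%N -> 0 < s m.
Proof.
by case: m => // m _; rewrite primitive_weightS ltr_wpDl ?primitive_weight_ge0//; exact: hw.
Qed.

Lemma primitive_weight_homo m n : (m <= n)%N -> s m <= s n.
Proof.
move=> /subnK <-; elim: (n - m)%N => // i IHi.
by rewrite addSn primitive_weightS (le_trans IHi)// lerDl; exact/ltW/hw.
Qed.

Lemma mulrn_weight_le m n : (m <= n)%N -> m%:R * w n <= s m.
Proof.
move=> le_mn; have -> : m%:R * w n = \sum_(i < m) w n.
  by rewrite sumr_const card_ord mulr_natl.
by apply: ler_sum => i _; apply: hmono; exact: leq_trans (ltnW (ltn_ord i)) le_mn.
Qed.

(** Each weight beyond the first [m] is at most their average, so the averages [s m / m] do not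
    increase; the cross-multiplied form also makes sense for [m = 0]. *)
Lemma primitive_weight_mean m n : (m <= n)%N -> m%:R * s n <= n%:R * s m.
Proof.
move=> /subnK <-; elim: (n - m)%N => // i IHi.
rewrite addSn primitive_weightS -natr1 mulrDr mulrDl mul1r lerD//.
by apply: mulrn_weight_le; exact: leq_addl.
Qed.

(* With [b] from the URP, splitting the sum at [q = m %/ b] works because
   [q / s q <= 1/2 * (m / s m)]. *)
Lemma URP_sum_inv : URP s ->
  exists2 K : R, 0 <= K & forall m, \sum_(j < m) (s j.+1)^-1 <= K * (m%:R / s m).
Proof.
move=> [b b_ge3 urp]; have b_gt0 : (0 < b)%N by exact: leq_trans b_ge3.
(* This constant reproduces itself in the induction: the head and the tail are each at most
   [b * (m / s m)]. *)
exists (2 * b%:R) => //; elim/ltn_ind => m IHm.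
have [->|m_gt0] := posnP m; first by rewrite big_ord0 !mul0r mulr0.
have sm_gt0 := primitive_weight_gt0 m_gt0.
(* For [m < b] every term is at most [1 / s 1], which is at most [m / s m], and there are fewer than
   [b] terms. *)
have [lt_mb|le_bm] := ltnP m b.
  have le1 : s m / m%:R <= s 1%N.
    by rewrite ler_pdivrMr ?ltr0n// mulrC -[leLHS]mul1r; exact: (@primitive_weight_mean 1).
  have s1_gt0 : 0 < s 1%N by exact: primitive_weight_gt0.
  apply: (@le_trans _ _ (m%:R * (s 1%N)^-1)).
    rewrite mulr_natl -[m in leRHS]card_ord -sumr_const; apply: ler_sum => i _.
    by rewrite lef_pV2 ?posrE ?primitive_weight_gt0//; exact: primitive_weight_homo.
  apply: ler_pM; rewrite ?invr_ge0 ?ler0n ?(ltW s1_gt0)//.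
    by rewrite -natrM ler_nat; lia.
  by rewrite -[_ / _]invrK invf_div lef_pV2 ?posrE// divr_gt0// ltr0n.
set q := (m %/ b)%N.
have q_gt0 : (0 < q)%N by rewrite divn_gt0.
have lt_qm : (q < m)%N by rewrite ltn_Pdiv//; lia.
have le_bqm : (b * q <= m)%N by rewrite mulnC leq_trunc_div.
have lt_mbq : (m <= 2 * (b * q))%N by have := ltn_ceil m b_gt0; rewrite -/q; nia.
have sq_gt0 := primitive_weight_gt0 q_gt0.
have bq_gt0 : 0 < (b * q)%:R :> R by rewrite ltr0n muln_gt0 b_gt0.
(* The URP compares [q / s q] with [b * q / s (b * q)], gaining the factor 2; monotonicity of the
   averages then passes from [b * q] to [m]. *)
have half : 2 * (q%:R / s q) <= m%:R / s m.
  have sbq_gt0 : 0 < s (b * q)%N by rewrite primitive_weight_gt0// muln_gt0 b_gt0.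
  apply: (@le_trans _ _ ((b * q)%:R / s (b * q)%N)).
    rewrite ler_pdivlMr// !mulrA mulrAC ler_pdivrMr//.
    have := ler_wpM2l (ltW (_ : 0 < q%:R :> R)) (urp q q_gt0); rewrite ltr0n => /(_ q_gt0).
    rewrite natrM => h; lra.
  rewrite ler_pdivrMr// mulrAC ler_pdivlMr//.
  exact: primitive_weight_mean.
have -> : \sum_(j < m) (s j.+1)^-1 =
    \sum_(j < q) (s j.+1)^-1 + \sum_(q <= j < m) (s j.+1)^-1.
  by rewrite -!(big_mkord xpredT (fun j => (s j.+1)^-1)) (@big_cat_nat _ _ _ q)//= ltnW.
have tail : \sum_(q <= j < m) (s j.+1)^-1 <= m%:R / s q.
  apply: (@le_trans _ _ (\sum_(q <= j < m) (s q)^-1)).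
    apply: ler_sum_nat => j /andP[le_qj _].
    rewrite lef_pV2 ?posrE ?primitive_weight_gt0// primitive_weight_homo//.
    exact: leqW.
  rewrite sumr_const_nat -[leLHS]mulr_natl ler_wpM2r ?invr_ge0 ?(ltW sq_gt0)//.
  by rewrite ler_nat leq_subr.
apply: le_trans (lerD (IHm q lt_qm) tail) _.
have : m%:R / s q <= b%:R * (2 * (q%:R / s q)).
  rewrite !mulrA ler_wpM2r ?invr_ge0 ?(ltW sq_gt0)//.
  by rewrite -natrM -natrM ler_nat; lia.
have := ler_wpM2l (ler0n R b) half.
set u := q%:R / s q; set v := m%:R / s m; set z := m%:R / s q.
move=> h1 h2; lra.
Qed.

End PrimitiveWeights.

(** * Finite sums controlled by a weak-type bound *)

Lemma fset_min {R : realDomainType} (A : {fset nat}) (a : nat -> R) :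
  (0 < #|` A|)%N -> exists2 n0, n0 \in A & {in A, forall n, a n0 <= a n}.
Proof.
rewrite cardfs_gt0 => /fset0Pn[i iA].
have [n0 _ n0_min] := @arg_minP _ _ _ [` iA]%fset xpredT (fun n : A => a (val n)) isT.
by exists (val n0) => [|n nA]; [exact: valP|exact: (n0_min [` nA]%fset)].
Qed.

Lemma ler_sum_fset {R : numDomainType} (A : {fset nat}) (r : seq nat) (a : nat -> R) :
  uniq r -> (forall n, 0 <= a n) -> \sum_(n <- r | n \in A) a n <= \sum_(n <- A) a n.
Proof.
move=> r_uniq a_ge0; rewrite [leRHS](bigID [in r])/= -[leLHS]addr0 lerD//; last exact: sumr_ge0.
rewrite -big_filter -[leRHS]big_filter le_eqVlt; apply/orP; left; apply/eqP/perm_big.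
apply: uniq_perm; rewrite ?filter_uniq ?fset_uniq// => n.
by rewrite !mem_filter andbC.
Qed.

(* If [t * s |B| <= L] whenever [a >= t] on [B], then the j-th largest value of
   [a] is at most [L / s j]. *)
Lemma weak_type_sum {R : realFieldType} (s a : nat -> R) (L : R) :
  (forall m, (0 < m)%N -> 0 < s m) -> (forall n, 0 <= a n) ->
  (forall (B : {fset nat}) t, 0 <= t -> {in B, forall n, t <= a n} -> t * s #|` B| <= L) ->
  forall A : {fset nat}, \sum_(n <- A) a n <= L * \sum_(j < #|` A|) (s j.+1)^-1.
Proof.
move=> s_gt0 a_ge0 weak A; move cardA : #|` A| => m; elim: m A cardA => [|m IHm] A cardA.
  by rewrite (cardfs0_eq cardA) big_seq_fset0 big_ord0 mulr0.
(* Removing the index of the smallest value peels off the last term of the right-hand sum: all of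
   [A] lies above that value, so the hypothesis applies with [B = A]. *)
have [|n0 n0A n0_min] := @fset_min _ A a; first by rewrite cardA.
rewrite (big_fsetD1 n0)//= big_ord_recr /= mulrDr addrC lerD//.
  by apply: IHm; move: cardA; rewrite (cardfsD1 n0) n0A => -[].
by rewrite ler_pdivlMr ?s_gt0// -cardA; exact: weak.
Qed.

(** * Weighted partial sums over a greedy set *)

Section GreedyPartialSums.
Context {R : realType} {k : scalar_kind}.
Variables (w : nat -> R) (a : nat -> scalars R k) (L L' K : R).
Hypotheses (hw : weight w) (hmono : nonincreasing_seq w).
Local Notation s := (primitive_weight w).
Hypotheses (K_ge0 : 0 <= K).
Hypothesis sum_inv_s : forall m, \sum_(j < m) (s j.+1)^-1 <= K * (m%:R / s m).
Hypothesis psum_le : forall M, modulus (\sum_(n < M) a n * embed k (w n)) <= L.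
Hypothesis weak : forall (B : {fset nat}) t, 0 <= t ->
  {in B, forall n, t <= modulus (a n)} -> t * s #|` B| <= L'.

Let L'_ge0 : 0 <= L'.
Proof. by have := @weak fset0 0 (lexx _); rewrite mul0r; apply => n; rewrite inE. Qed.

(* The partial sum is cut at [m = |A|]. Before [m] it differs from a partial sum
   of [a] by coefficients of modulus at most [t = min_A |a|], and [t * s m <= L'].
   After [m], [w n <= s m / m] and [weak_type_sum] applies. *)
Lemma greedy_partial_sum (A : {fset nat}) (M : nat) :
  (forall n j, n \in A -> j \notin A -> modulus (a j) <= modulus (a n)) ->
  modulus (\sum_(n < M) (if (n : nat) \in A then a n else 0) * embed k (w n)) <= L + L' + K * L'.
Proof.
move=> gA; set F := fun n => (if n \in A then a n else 0) * embed k (w n).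
have modw n : modulus (embed k (w n)) = w n by rewrite modulus_embed gtr0_norm.
(* The partial sum may stop before [m], hence the minimum; the tail is then empty. *)
set m := #|` A|; set m0 := minn m M.
have -> : \sum_(n < M) F n = \sum_(n < m0) F n + \sum_(m0 <= n < M) F n.
  by rewrite -!(big_mkord xpredT F) (@big_cat_nat _ _ _ m0)//= geq_minr.
apply: le_trans (ler_modulusD _ _) _; apply: lerD; last first.
  have [le_Mm|lt_mM] := leqP M m.
    have -> : m0 = M by exact/minn_idPr.
    by rewrite big_geq// modulus0 mulr_ge0.
  have -> : m0 = m by apply/minn_idPl; exact: ltnW.
  have [m_eq0|m_gt0] := posnP m.
    rewrite big1 ?modulus0 ?mulr_ge0// => n _.
    by rewrite /F (cardfs0_eq m_eq0) inE mul0r.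
  have sm_gt0 := primitive_weight_gt0 hw m_gt0.
  have mR_gt0 : 0 < m%:R :> R by rewrite ltr0n.
  apply: (@le_trans _ _ (\sum_(m <= n < M | n \in A) modulus (a n) * (s m / m%:R))).
    apply: le_trans (ler_modulus_sum _ _ _) _; rewrite [leRHS]big_mkcond/=.
    apply: ler_sum_nat => n /andP[le_mn _].
    rewrite /F; case: ifP => _; last by rewrite mul0r modulus0.
    rewrite modulusM modw ler_wpM2l ?modulus_ge0// ler_pdivlMr// mulrC.
    exact: mulrn_weight_le.
  (* It remains to bound the sum of the moduli over [A]: the factor [m / s m] supplied by
     [sum_inv_s] cancels [s m / m]. *)
  rewrite -mulr_suml mulrC -ler_pdivlMl ?divr_gt0// invf_div.
  apply: le_trans (ler_sum_fset _ (iota_uniq _ _) _) _; first by move=> n; exact: modulus_ge0.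
  apply: le_trans (weak_type_sum _ _ weak A) _.
  - exact: primitive_weight_gt0.
  - by move=> n; exact: modulus_ge0.
  by rewrite mulrCA mulrA mulrC ler_wpM2r// mulrC.
(* [G] collects the terms off [A], whose coefficients the greedy property bounds by the minimum over
   [A]. *)
pose G n := (if n \in A then 0 else a n) * embed k (w n).
have -> : \sum_(n < m0) F n = \sum_(n < m0) a n * embed k (w n) - \sum_(n < m0) G n.
  rewrite -sumrB; apply: eq_bigr => n _; rewrite /F /G.
  by case: ifP; rewrite mul0r ?subr0 ?subrr.
apply: le_trans (ler_modulusB _ _) _; apply: lerD => //.
have [m_eq0|m_gt0] := posnP m.
  by rewrite /m0 m_eq0 min0n big_ord0 modulus0.
have [n0 n0A n0_min] := fset_min (fun n => modulus (a n)) m_gt0.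
apply: le_trans (weak (modulus_ge0 (a n0)) n0_min).
apply: (@le_trans _ _ (modulus (a n0) * s m0)); last first.
  by rewrite ler_wpM2l ?modulus_ge0// primitive_weight_homo// geq_minl.
apply: le_trans (ler_modulus_sum _ _ _) _; rewrite mulr_sumr; apply: ler_sum => n _.
rewrite /G modulusM modw ler_wpM2r ?(ltW (hw _))//.
by case: ifPn => [_|nNA]; [rewrite modulus0 modulus_ge0|exact: gA].
Qed.

End GreedyPartialSums.

(** * Closed linear spans in a quasi-Banach space *)

Lemma cvg0P {R : realType} (v : nat -> R) : (forall n, 0 <= v n) ->
  v @ \oo --> (0 : R) <->
  forall e : R, 0 < e -> exists n0, forall n, (n0 <= n)%N -> v n < e.
Proof.
move=> v_ge0; split=> [/cvgrPdist_lt cv e e_gt0|cv].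
  have [n0 _ hn0] := cv e e_gt0; exists n0 => n le_n.
  by have := hn0 n le_n; rewrite /= sub0r normrN ger0_norm.
apply/cvgrPdist_lt => e e_gt0; have [n0 hn0] := cv e e_gt0.
by exists n0 => // n /= le_n; rewrite sub0r normrN ger0_norm//; exact: hn0.
Qed.

Section ClosedSpan.
Context {R : realType} {k : scalar_kind} {V : lmodType (scalars R k)}.
Variables (Y : set V) (N : V -> R) (x : nat -> V).

Lemma lin_span0 : lin_span x 0.
Proof. by exists 0%N, (fun=> 0); rewrite big_ord0. Qed.

Lemma lin_span_mem n : lin_span x (x n).
Proof.
exists n.+1, (fun j => (j == n)%:R); rewrite big_ord_recr/= eqxx scale1r big1 ?add0r// => j _.
by rewrite lt_eqF ?scale0r//; exact: ltn_ord.
Qed.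

Lemma lin_span_linear a f g : lin_span x f -> lin_span x g -> lin_span x (a *: f + g).
Proof.
move=> [m [c ->]] [p [d ->]].
(* Padding with zeros brings both combinations to a common length. *)
have widen (q M : nat) (e : nat -> scalars R k) : (q <= M)%N ->
    \sum_(n < q) e n *: x n = \sum_(n < M) (if (n < q)%N then e n else 0) *: x n.
  move=> le_qM; rewrite (big_ord_widen M (fun n => e n *: x n))// big_mkcond.
  by apply: eq_bigr => n _; case: ifP; rewrite ?scale0r.
exists (maxn m p), (fun n => a * (if (n < m)%N then c n else 0) + if (n < p)%N then d n else 0).
rewrite (widen m (maxn m p)) ?leq_maxl// (widen p (maxn m p)) ?leq_maxr//.
rewrite scaler_sumr -big_split; apply: eq_bigr => n _.
by rewrite /= scalerDl scalerA.
Qed.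

Hypotheses (hY : quasi_banach Y N) (Yx : forall n, Y (x n)).

Lemma lin_span_sub : lin_span x `<=` Y.
Proof.
have sY := qb_subspace hY.
by move=> f [m [c ->]]; apply: subspace_sum => // n; apply: subspaceZ => //; exact: Yx.
Qed.

Lemma closed_lin_span_sub : closed_lin_span Y N x `<=` Y.
Proof. by move=> f []. Qed.

Lemma lin_span_closed : lin_span x `<=` closed_lin_span Y N x.
Proof.
move=> f xf; split=> [|e e_gt0]; first exact: lin_span_sub.
by exists f => //; rewrite subrr (quasi_norm0 (qb_subspace hY) (qb_norm hY)).
Qed.

(** A basis must span the space it is declared in, here the closed span itself; the approximating
    vectors are the same in both closures. *)
Lemma closed_lin_span_id :
  closed_lin_span (closed_lin_span Y N x) N x = closed_lin_span Y N x.
Proof. by apply/seteqP; split=> [f []//|f Yf]; split=> //; case: Yf. Qed.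

(** Linearity and closedness both come from the quasi-triangle inequality: a limit is close to some
    [u n0], which is close to the span. *)
Lemma closed_lin_span_banach : quasi_banach (closed_lin_span Y N x) N.
Proof.
have [sY nY cY] := hY; have [kappa kappa_ge1 tri] := qn_triangle nY.
have kappa_gt0 : 0 < kappa by exact: lt_le_trans kappa_ge1.
split.
- split; first exact/lin_span_closed/lin_span0.
  move=> a f g [Yf af] [Yg ag]; split=> [|e e_gt0].
    by apply: subspaceD => //; exact: subspaceZ.
  (* Two errors below [e1] add up to less than [e] after the factor [kappa]; the 1 added to
     [modulus a] below covers [a = 0]. *)
  pose e1 := e / (2 * kappa).
  have e1_gt0 : 0 < e1 by rewrite divr_gt0// mulr_gt0.
  have a1_gt0 : 0 < modulus a + 1 by rewrite ltr_wpDl ?modulus_ge0.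
  have [f' f'x lt_f] := af (e1 / (modulus a + 1)) (divr_gt0 e1_gt0 a1_gt0).
  have [g' g'x lt_g] := ag e1 e1_gt0.
  exists (a *: f' + g'); first exact: lin_span_linear.
  have [Yf' Yg'] := (lin_span_sub f'x, lin_span_sub g'x).
  have Yff : Y (f - f') by exact: subspaceB.
  have Ygg : Y (g - g') by exact: subspaceB.
  rewrite opprD addrACA -scalerBr.
  apply: le_lt_trans (tri _ _ (subspaceZ sY _ Yff) Ygg) _; rewrite (qn_scale nY)//.
  have : modulus a * N (f - f') <= e1.
    apply: (@le_trans _ _ ((modulus a + 1) * N (f - f'))).
      by rewrite ler_wpM2r ?lerDl//; exact: (qn_ge0 nY).
    by rewrite mulrC -ler_pdivlMr// ltW.
  move=> h; have : modulus a * N (f - f') + N (g - g') < e1 + e1 by exact: ler_ltD.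
  rewrite -(ltr_pM2l kappa_gt0) => /lt_le_trans; apply.
  by rewrite (_ : kappa * (e1 + e1) = e)// /e1; field; rewrite gt_eqF.
- split.
  + by move=> f [Yf _]; exact: (qn_ge0 nY).
  + by move=> f [Yf _]; exact: (qn_eq0 nY).
  + by move=> a f [Yf _]; exact: (qn_scale nY).
  + by exists kappa => // f g [Yf _] [Yg _]; exact: tri.
- move=> u Yu cu; have [f Yf uf] := cY u (fun n => (Yu n).1) cu.
  exists f => //; split=> // e e_gt0.
  have e1_gt0 : 0 < e / (2 * kappa) by rewrite divr_gt0// mulr_gt0.
  have Yuf n : Y (u n - f) by apply: subspaceB => //; exact: (Yu n).1.
  have /(_ _ e1_gt0)[n0 /(_ n0 (leqnn _)) lt_uf] :=
    (cvg0P (fun n => qn_ge0 nY (Yuf n))).1 uf.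
  have [g gx lt_ug] := (Yu n0).2 _ e1_gt0; exists g => //.
  have Yg := lin_span_sub gx; have Yun := (Yu n0).1.
  rewrite -[f](subrK (u n0)) -addrA.
  apply: le_lt_trans (tri _ _ (subspaceB sY Yf Yun) (subspaceB sY Yun Yg)) _.
  rewrite (quasi_normB sY nY)//.
  have := ltrD lt_uf lt_ug; rewrite -(ltr_pM2l kappa_gt0) => /lt_le_trans; apply.
  by rewrite -mulr2n -mulr_natr (_ : kappa * _ = e)//; field; rewrite gt_eqF.
Qed.

Lemma M_bounded_of_le xs (D E : R) : 0 <= D ->
  (forall n f, Y f -> modulus (xs n f) <= D * N f) -> (forall n, N (x n) <= E) ->
  M_bounded Y N x xs.
Proof.
move=> D_ge0 hD hE; apply: le_lt_trans (ltry (E * D)); apply: ge_ereal_sup => _ [n _ <-].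
rewrite EFinM; apply: lee_pmul => //.
- by rewrite lee_fin; exact: (qn_ge0 (qb_norm hY)).
- apply: (@le_trans _ _ (modulus (xs n 0))%:E); first by rewrite lee_fin modulus_ge0.
  apply: ereal_sup_ubound; exists 0 => //.
  rewrite /= (quasi_norm0 (qb_subspace hY) (qb_norm hY)); split=> //.
  exact: (subspace0 (qb_subspace hY)).
- by rewrite lee_fin.
- apply: ge_ereal_sup => _ [f [Yf Nf] <-]; rewrite lee_fin (le_trans (hD n f Yf))//.
  by rewrite -[leRHS]mulr1 ler_wpM2l.
Qed.

End ClosedSpan.

(** * The space [KT] and its quasi-norm *)

Section KonyaginTemlyakov.
Context {R : realType} {k : scalar_kind}.
Variables (X : set (scalar_seq R k)) (N : scalar_seq R k -> R) (w : nat -> R).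
Implicit Types f g : scalar_seq R k.

(** The scalar whose modulus enters the supremum [wnorm]. Before the modulus is taken it is linear
    in [f], and the properties of the weighted part of the quasi-norm follow from this. *)
Definition psum M f : scalars R k := \sum_(n < M.+1) coordf n f * embed k (w n).

Lemma psum_linear M a f g : psum M (a *: f + g) = a * psum M f + psum M g.
Proof.
rewrite /psum mulr_sumr -big_split; apply: eq_bigr => n _.
have -> : coordf n (a *: f + g) = a * coordf n f + coordf n g by [].
by rewrite mulrDl mulrA.
Qed.

Lemma psum0 M : psum M 0 = 0.
Proof. by rewrite /psum big1// => n _; rewrite /coordf mul0r. Qed.

Lemma psumB M f g : psum M (f - g) = psum M f - psum M g.
Proof. by rewrite addrC -scaleN1r psum_linear mulN1r addrC. Qed.

Lemma wnorm_ubound f (B : R) : (forall M, modulus (psum M f) <= B) -> (wnorm w f <= B%:E)%E.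
Proof. by move=> hB; apply: ge_ereal_sup => _ [M _ <-]; rewrite lee_fin; exact: hB. Qed.

(** The supremum dominates a modulus, so it cannot be [-oo], and [fine] in [KTnorm] loses nothing on
    [KT]. *)
Lemma wnorm_fin f : (wnorm w f < +oo)%E -> wnorm w f = (fine (wnorm w f))%:E.
Proof.
move=> f_fin; rewrite fineK// fin_numElt f_fin andbT.
rewrite (@lt_le_trans _ _ (modulus (psum 0 f))%:E) ?ltNyr//.
by apply: ereal_sup_ubound; exists 0%N.
Qed.

Lemma psum_le f M : (wnorm w f < +oo)%E -> modulus (psum M f) <= fine (wnorm w f).
Proof.
by move=> /wnorm_fin f_fin; rewrite -lee_fin -f_fin; apply: ereal_sup_ubound; exists M.
Qed.

Lemma psum_le_KTnorm f M : KT X w f -> modulus (psum M f) <= KTnorm N w f.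
Proof. by move=> [_ f_fin]; rewrite /KTnorm le_max psum_le ?orbT. Qed.

Lemma norm_le_KTnorm f : N f <= KTnorm N w f.
Proof. by rewrite /KTnorm le_max lexx. Qed.

Lemma KT_of_psum f (B : R) : X f -> (forall M, modulus (psum M f) <= B) -> KT X w f.
Proof. by move=> Xf /wnorm_ubound leB; split=> //; exact: le_lt_trans leB (ltry B). Qed.

Lemma KTnorm_le f (B : R) : N f <= B -> (forall M, modulus (psum M f) <= B) ->
  KTnorm N w f <= B.
Proof.
move=> NB hB; have := wnorm_ubound hB => leB.
by rewrite /KTnorm ge_max NB -lee_fin -wnorm_fin// (le_lt_trans leB) ?ltry.
Qed.

Hypothesis hX : quasi_banach X N.
Let sX := qb_subspace hX.
Let nX := qb_norm hX.

Lemma KTnorm_ge0 f : KT X w f -> 0 <= KTnorm N w f.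
Proof. by move=> [Xf _]; apply: le_trans (norm_le_KTnorm f); exact: (qn_ge0 nX). Qed.

Lemma KT_subspace : linear_subspace (KT X w).
Proof.
split.
  apply: (@KT_of_psum _ 0) => [|M]; first exact: (subspace0 sX).
  by rewrite psum0 modulus0.
move=> a f g [Xf wf] [Xg wg].
apply: (@KT_of_psum _ (modulus a * fine (wnorm w f) + fine (wnorm w g))) => [|M].
  exact: sX.2.
rewrite psum_linear (le_trans (ler_modulusD _ _))// modulusM lerD ?psum_le//.
by rewrite ler_wpM2l ?modulus_ge0 ?psum_le.
Qed.

Lemma KT_quasi_norm : quasi_norm (KT X w) (KTnorm N w).
Proof.
have [kappa kappa_ge1 tri] := qn_triangle nX.
have kappa_gt0 : 0 < kappa by exact: lt_le_trans kappa_ge1.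
(* Only one inequality is direct; the reverse one follows by applying this to [a^-1] and
   [a *: f]. *)
have le_scale a f : KT X w f -> KTnorm N w (a *: f) <= modulus a * KTnorm N w f.
  move=> KTf; have [Xf _] := KTf; apply: KTnorm_le => [|M].
    by rewrite (qn_scale nX)// ler_wpM2l ?modulus_ge0// norm_le_KTnorm.
  rewrite -[a *: f]addr0 psum_linear psum0 addr0 modulusM.
  by rewrite ler_wpM2l ?modulus_ge0// psum_le_KTnorm.
split.
- exact: KTnorm_ge0.
- move=> f KTf; have [Xf _] := KTf; split=> [f0|->].
    apply/(qn_eq0 nX Xf)/le_anti; rewrite (qn_ge0 nX)// andbT -f0.
    exact: norm_le_KTnorm.
  apply/le_anti/andP; split; last exact/KTnorm_ge0/(subspace0 KT_subspace).
  by apply: KTnorm_le => [|M]; rewrite ?(quasi_norm0 sX nX)// psum0 modulus0.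
- move=> a f KTf; apply/le_anti/andP; split; first exact: le_scale.
  have [->|a0] := eqVneq a 0.
    by rewrite modulus0 mul0r; exact/KTnorm_ge0/(subspaceZ KT_subspace).
  have a_gt0 : 0 < modulus a.
    rewrite lt_def modulus_ge0 andbT; apply: contra_neq a0; exact: modulus0_eq0.
  have := le_scale a^-1 _ (subspaceZ KT_subspace a KTf).
  rewrite scalerA mulVf// scale1r -(ler_pM2l a_gt0) mulrA -modulusM divff// modulus1.
  by rewrite mul1r.
(* The weighted part satisfies the triangle inequality with constant 1, so [kappa] still works. *)
- exists kappa => // f g KTf KTg; have [[Xf _] [Xg _]] := (KTf, KTg).
  apply: KTnorm_le => [|M].
    by rewrite (le_trans (tri _ _ Xf Xg))// ler_pM2l// lerD// norm_le_KTnorm.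
  rewrite -[f]scale1r psum_linear mul1r scale1r (le_trans (ler_modulusD _ _))//.
  apply: (@le_trans _ _ (KTnorm N w f + KTnorm N w g)).
    by rewrite lerD ?psum_le_KTnorm.
  by rewrite ler_peMl// addr_ge0 ?KTnorm_ge0.
Qed.

(** Each partial sum is continuous on [X]. The constant depends on [M], which is enough to take
    limits at a fixed [M]. *)
Lemma psum_bound (D : R) M : (forall n f, X f -> modulus (coordf n f) <= D * N f) ->
  forall f, X f -> modulus (psum M f) <= (D * \sum_(n < M.+1) `|w n|) * N f.
Proof.
move=> hD f Xf; rewrite mulrAC mulr_sumr.
apply: le_trans (ler_modulus_sum _ _ _) _; apply: ler_sum => n _.
by rewrite modulusM modulus_embed ler_wpM2r// hD.
Qed.

(** The limit exists in [X]. For fixed [M] the Cauchy bound on the partial sums passes to that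
    limit, and the resulting bound does not depend on [M]. *)
Lemma KT_complete (D : R) : 0 <= D ->
  (forall n f, X f -> modulus (coordf n f) <= D * N f) ->
  quasi_complete (KT X w) (KTnorm N w).
Proof.
move=> D_ge0 hD u KTu cu.
have [||f Xf uf] := qb_complete hX (u := u); first by move=> n; exact: (KTu n).1.
  move=> e /cu[n0 hn0]; exists n0 => m n le_m le_n.
  exact: le_lt_trans (norm_le_KTnorm _) (hn0 m n le_m le_n).
have Xuf n : X (u n - f) by apply: (subspaceB sX) => //; exact: (KTu n).1.
have {}uf := (cvg0P (fun n => qn_ge0 nX (Xuf n))).1 uf.
have KTuu m n : KT X w (u m - u n) by exact: (subspaceB KT_subspace).
have psum_small e n0 : 0 < e ->
    (forall m n, (n0 <= m)%N -> (n0 <= n)%N -> KTnorm N w (u m - u n) < e) ->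
    forall n M, (n0 <= n)%N -> modulus (psum M (u n - f)) <= e.
  move=> e_gt0 hn0 n M le_n; apply/ler_addgt0Pr => d d_gt0.
  pose W := D * \sum_(n < M.+1) `|w n|.
  have W_ge0 : 0 <= W by rewrite mulr_ge0// sumr_ge0.
  (* [W] may vanish, so the division is by [W + 1]. The index [q] found from it depends on [M], but
     the bound [e] does not. *)
  have W1_gt0 : 0 < W + 1 by rewrite ltr_wpDl.
  have [p hp] := uf _ (divr_gt0 d_gt0 W1_gt0).
  pose q := maxn n0 p.
  have -> : u n - f = (u n - u q) - (f - u q) by rewrite opprB addrA subrK.
  rewrite psumB (le_trans (ler_modulusB _ _))// lerD//.
    rewrite (le_trans (psum_le_KTnorm M (KTuu n q)))// ltW// hn0//.
    exact: leq_maxl.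
  rewrite -opprB -[- _]scaleN1r -[_ *: _]addr0 psum_linear psum0 addr0 mulN1r modulusN.
  apply: le_trans (psum_bound M hD (Xuf q)) _; rewrite -/W.
  have := hp q (leq_maxr _ _); rewrite ltr_pdivlMr// => lt_d.
  rewrite mulrC (le_trans _ (ltW lt_d))// ler_wpM2l ?lerDl//.
  exact: (qn_ge0 nX).
have KTf : KT X w f.
  have [n0 hn0] := cu 1 ltr01.
  (* The limit is [u n0] minus a vector of [X] whose partial sums are at most 1, hence a difference
     of members of [KT]. *)
  rewrite -[f](subKr (u n0)); apply: (subspaceB KT_subspace) => //.
  by apply: (@KT_of_psum _ 1) => // M; exact: psum_small hn0 _ _ (leqnn _).
exists f => //; apply/cvg0P => [n|e e_gt0].
  by apply: KTnorm_ge0; exact: (subspaceB KT_subspace).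
have e2_gt0 : 0 < e / 2 by rewrite divr_gt0.
have [n0 hn0] := cu _ e2_gt0; have [n1 hn1] := uf _ e2_gt0.
exists (maxn n0 n1) => n; rewrite geq_max => /andP[le0 le1].
apply: (@le_lt_trans _ _ (e / 2)); last by rewrite ltr_pdivrMr// mulr_natr mulr2n ltrDl.
apply: KTnorm_le => [|M]; first exact/ltW/hn1.
exact: psum_small hn0 _ _ le0.
Qed.

Lemma psum_unit_vector M n : modulus (psum M (unit_vector n)) <= `|w n|.
Proof.
rewrite /psum /coordf /unit_vector.
have [lt_nM|le_Mn] := ltnP n M.+1.
  rewrite (bigD1 (Ordinal lt_nM))//= eqxx mul1r big1 ?addr0 ?modulus_embed// => i.
  by rewrite -val_eqE /= => /negPf->; rewrite mul0r.
rewrite big1 ?modulus0// => i _; rewrite ltn_eqF ?mul0r//.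
exact: leq_trans (ltn_ord i) le_Mn.
Qed.

End KonyaginTemlyakov.

Theorem theorem10p39 (R : realType) (k : scalar_kind)
    (X : set (scalar_seq R k)) (N : scalar_seq R k -> R) (w : nat -> R)
    (hX : quasi_banach X N)
    (hgreedy : greedy_basis X N unit_vector coordf)
    (hw : weight w) (hmono : nonincreasing_seq w)
    (hfund : equivalent_seq (fundamental_function N unit_vector)
               (fun m => (primitive_weight w m)%:E))
    (hLRP : LRP (primitive_weight w)) (hURP : URP (primitive_weight w)) :
  quasi_greedy_basic_sequence (KT X w) (KTnorm N w) unit_vector coordf.
Proof.
have [hB Mb sn _] := hgreedy.
have nX := qb_norm hX.
have [D D_ge0 D_bound] := coord_bound hB Mb sn.
have [C C_ge0 C_greedy] := greedy_basis_ge0 hgreedy.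
have [P P_ge0 P_proj] := greedy_proj_bounded hB C_greedy C_ge0 D_bound.
have [K' K'_ge0 weak] := greedy_weak_type hgreedy (primitive_weight_gt0 hw)
  (primitive_weight0 w) hfund.
have [K K_ge0 sum_inv] := URP_sum_inv hw hmono hURP.
have hKT : quasi_banach (KT X w) (KTnorm N w).
  by split; [apply: KT_subspace hX|apply: KT_quasi_norm hX|exact: (KT_complete hX D_ge0 D_bound)].
have w_le n : `|w n| <= w 0%N by rewrite gtr0_norm//; exact: hmono.
have KTe n : KT X w (unit_vector n).
  by apply: KT_of_psum (Defs.basis_mem hB n) _ => M; exact: psum_unit_vector.
have D_KT n f : KT X w f -> modulus (coordf n f) <= D * KTnorm N w f.
  move=> [Xf _]; apply: le_trans (D_bound n f Xf) _.
  by rewrite ler_wpM2l// norm_le_KTnorm.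
have [E hE] : exists E, forall n, KTnorm N w (unit_vector n) <= E.
  pose S := ereal_sup (range (fun n => (N (unit_vector n))%:E)).
  have leS n : ((N (unit_vector n))%:E <= S)%E by apply: ereal_sup_ubound; exists n.
  have S_fin : S \is a fin_num.
    by rewrite fin_numElt sn.2 andbT (lt_le_trans _ (leS 0%N))// ltNyr.
  (* The partial sums of a unit vector have modulus at most [w n], hence at most [w 0], as the
     weight is non-increasing. *)
  exists (Num.max (fine S) (w 0%N)) => n; apply: KTnorm_le => [|M].
    by rewrite le_max -lee_fin fineK// leS.
  by rewrite le_max; apply/orP; right; exact: le_trans (psum_unit_vector w M n) (w_le n).
split=> //; set Y := closed_lin_span _ _ _.
have hY : quasi_banach Y (KTnorm N w) by exact: closed_lin_span_banach.
have YKT : Y `<=` KT X w by exact: closed_lin_span_sub.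
have D_Y n f : Y f -> modulus (coordf n f) <= D * KTnorm N w f by move=> /YKT; exact: D_KT.
split.
- split=> //.
  + by move=> n; apply: lin_span_closed => //; exact: lin_span_mem.
  + exact: closed_lin_span_id.
  + move=> n; split=> //; apply: (@le_lt_trans _ _ D%:E); last exact: ltry.
    apply: ge_ereal_sup => _ [f [Yf Nf] <-]; rewrite lee_fin (le_trans (D_Y n f Yf))//.
    by rewrite -[leRHS]mulr1 ler_wpM2l.
- by apply: M_bounded_of_le D_Y hE => // n; apply: lin_span_closed => //; exact: lin_span_mem.
- split; last first.
    by apply: le_lt_trans (ltry E); apply: ge_ereal_sup => _ [n _ <-]; rewrite lee_fin.
  (* The new quasi-norm dominates [N], so the positive lower bound on the unit vectors is
     inherited. *)
  apply: lt_le_trans sn.1 _; apply: le_ereal_inf_tmp => _ [n _ <-].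
  apply: ge_ereal_inf; exists (N (unit_vector n))%:E; first by exists n.
  by rewrite lee_fin norm_le_KTnorm.
(* [P] serves the [X] part. The rest is the bound [L + L' + K * L'] with [L] the [KT] quasi-norm of
   [f] and [L' = K' * L]. *)
- exists (P + (1 + K' + K * K')) => f A /YKT KTf gA.
  have [Xf _] := KTf; have Nf_ge0 := KTnorm_ge0 hX KTf.
  rewrite mulrDl; apply: KTnorm_le => [|M].
    apply: le_trans (P_proj f A Xf) _; apply: (@le_trans _ _ (P * KTnorm N w f)).
      by rewrite ler_wpM2l// norm_le_KTnorm.
    by rewrite lerDl mulr_ge0// !addr_ge0// mulr_ge0.
  rewrite -[leLHS]add0r lerD ?mulr_ge0//.
  have -> : psum w M (coord_proj unit_vector coordf A f) =
      \sum_(n < M.+1) (if (n : nat) \in A then coordf n f else 0) * embed k (w n).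
    by apply: eq_bigr => n _; rewrite (coord_fset_comb hB A (coordf^~ f)).
  rewrite !mulrDl mul1r -mulrA; apply: greedy_partial_sum => //.
    (* [psum] starts with one term, so the empty partial sum is treated apart. *)
    by case=> [|m]; [rewrite big_ord0 modulus0|exact: (psum_le_KTnorm N m KTf)].
  move=> B t t_ge0 f_ge; apply: le_trans (weak f B t Xf t_ge0 f_ge) _.
  by rewrite ler_wpM2l// norm_le_KTnorm.
Qed.
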